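(* Let $a,b,c$ be non-negative real numbers with $a+b+c=1$, and let $E(i_n(a,b,c))$ be the expected value of the number of independent sets of the random hexagonal cactus $R_n(a,b,c)$. Put \[\sigma_1=\sqrt{9a^2+42ab+30ac+130a+49b^2+70bc+26b+25c^2+78c+25},\quad \sigma_2=25a-11b+7c,\quad \sigma_3=9a^2+49b^2+25c^2-20+53a-15b+19c.\] Then, as $n\to\infty$, \[ E(i_n(a,b,c))\approx \frac{\frac{1}{0.5^{n+1}}\left(-3a\sigma_1-7b\sigma_1-5c\sigma_1+42ab+30ac+70bc+4\sigma_1+\sigma_3\right)}{\left(-\frac{3a+7b+5c-\sigma_1+5}{\sigma_2}\right)^{n+1}\sigma_1\sigma_2}, \] where $\approx$ means asymptotic equivalence (the ratio of the two sides tends to $1$).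
   Context: An independent set of a graph is a set of vertices no two of which are adjacent (the empty set counts as an independent set; the empty graph has exactly one independent set). A hexagon is a cycle $C_6$. The random hexagonal cactus $R_n(a,b,c)$, for non-negative reals $a,b,c$ with $a+b+c=1$, is defined recursively: $R_0(a,b,c)$ is the empty graph; $R_1(a,b,c)$ is a hexagon; $R_2(a,b,c)$ is obtained from two hexagons by identifying one vertex of one with one vertex of the other. For $n\ge 3$, label the hexagons of $R_{n-1}(a,b,c)$ as $1,\dots,n-1$ consecutively along the chain; the $(n-1)$-th hexagon contains a cut vertex $v$ (shared with the $(n-2)$-th hexagon). Then $R_n(a,b,c)$ is obtained from $R_{n-1}(a,b,c)$ and a new hexagon $H$ by identifying a vertex of $H$ with a vertex of the $(n-1)$-th hexagon that is at distance one from $v$ with probability $a$, at distance two from $v$ with probability $b$, or at distance three from $v$ with probability $c$ (distances measured in the $(n-1)$-th hexagon), independently at each step.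
   Formalization: The formal theorem adds the hypothesis σ₂ = 25a − 11b + 7c ≠ 0, since the displayed formula divides by σ₂ and is undefined when σ₂ = 0 (e.g. a = 11/36, b = 25/36, c = 0). *)

(* Defs.v *)
From HB Require Import structures.
From mathcomp Require Import all_boot all_order all_algebra.
From mathcomp Require Import all_classical all_reals all_analysis.
Set Implicit Arguments.
Unset Strict Implicit.
Unset Printing Implicit Defensive.
Import Order.TTheory GRing.Theory Num.Theory.
Import numFieldNormedType.Exports.

Structure graph := Graph {
  vertex :> finType;
  adj : rel vertex;
  adj_sym : symmetric adj;
  adj_irr : irreflexive adj }.

Definition independent (G : graph) (A : {set G}) : bool :=
  [forall x in A, forall y in A, ~~ adj x y].

Definition num_indep (G : graph) : nat :=
  #|[set A : {set G} | independent A]|.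

(* Length of a shortest walk from x to y; the value is #|G| when y cannot be
   reached from x. *)
Definition gdist (G : graph) (x y : G) : nat :=
  find (fun l => [exists p : l.-tuple G, path (@adj G) x p && (last x p == y)])
       (iota 0 #|G|).

Definition empty_adj : rel void := fun _ _ => false.

Lemma empty_adj_sym : symmetric empty_adj. Proof. by []. Qed.

Lemma empty_adj_irr : irreflexive empty_adj. Proof. by []. Qed.

Definition empty_graph : graph := Graph empty_adj_sym empty_adj_irr.

Definition hex_adj : rel 'I_6 := fun i j => (j == ordS i) || (i == ordS j).

Lemma hex_adj_sym : symmetric hex_adj.
Proof. by move=> i j; rewrite /hex_adj orbC. Qed.

Lemma hex_adj_irr : irreflexive hex_adj.
Proof. by case; do 6?[case=> //]. Qed.

Definition hexagon : graph := Graph hex_adj_sym hex_adj_irr.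

(* The disjoint union of G and H with the vertex v of H identified with the
   vertex u of G: the merged vertex is represented by inl u. *)
Section Glue.
Variables (G H : graph) (u : G) (v : H).

Definition glue_vertex : finType := (G + {x : H | x != v})%type.

Definition glue_adj : rel glue_vertex := fun x y =>
  match x, y with
  | inl x, inl y => adj x y
  | inr x, inr y => adj (val x) (val y)
  | inl x, inr y => (x == u) && adj v (val y)
  | inr x, inl y => (y == u) && adj v (val x)
  end.

Lemma glue_adj_sym : symmetric glue_adj.
Proof. by move=> [x|x] [y|y] //=; rewrite adj_sym. Qed.

Lemma glue_adj_irr : irreflexive glue_adj.
Proof. by move=> [x|x] /=; rewrite adj_irr. Qed.

Definition glue : graph := Graph glue_adj_sym glue_adj_irr.

Definition glue_inr (x : H) : glue :=
  if insub x is Some y then inr y else inl u.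

End Glue.

(* A chain of hexagons together with the cyclic labelling of its last hexagon.
   When there are at least two hexagons, label 0 is the cut vertex shared with
   the last but one. *)
Record hex_chain := HexChain {
  chain_graph : graph;
  last_hex : hexagon -> chain_graph }.

Definition attach (C : hex_chain) (j : hexagon) : hex_chain :=
  HexChain (@glue_inr (chain_graph C) hexagon (@last_hex C j) ord0).

(* chain s m has m.+1 hexagons. The second hexagon is attached at an arbitrary
   vertex of the first one; later hexagons are attached at the vertices s_0,
   s_1, ... of the hexagon that is then the last one. *)
Fixpoint chain (s : seq hexagon) (m : nat) : hex_chain :=
  if m isn't m'.+1 then @HexChain hexagon id
  else attach (chain s m') (if m' is k.+1 then nth ord0 s k else ord0).

Definition cactus (s : seq hexagon) (n : nat) : graph :=
  if n is m.+1 then chain_graph (chain s m) else empty_graph.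

Local Open Scope ring_scope.

(* p j is the probability of attaching the next hexagon at the vertex labelled
   j. Only the law of its distance to the cut vertex is prescribed: the way the
   two vertices at distance one (or two) share the mass a (or b) is free. *)
Definition step_law (R : realType) (a b c : R) (p : hexagon -> R) : Prop :=
  [/\ forall j, 0 <= p j,
      \sum_j p j = 1,
      \sum_(j | gdist (ord0 : hexagon) j == 1%N) p j = a,
      \sum_(j | gdist (ord0 : hexagon) j == 2%N) p j = b &
      \sum_(j | gdist (ord0 : hexagon) j == 3%N) p j = c].

(* The n - 2 random choices are independent, hence the product weights. *)
Definition expected_num_indep (R : realType) (p : nat -> hexagon -> R)
    (n : nat) : R :=
  \sum_(s : (n - 2).-tuple hexagon)
    (\prod_(k < n - 2) p k (tnth s k)) * (num_indep (cactus s n))%:R.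

Section Sigma.
Variables (R : realType) (a b c : R).

Definition sigma1 : R :=
  Num.sqrt (9 * a ^+ 2 + 42 * a * b + 30 * a * c + 130 * a + 49 * b ^+ 2
            + 70 * b * c + 26 * b + 25 * c ^+ 2 + 78 * c + 25).

Definition sigma2 : R := 25 * a - 11 * b + 7 * c.

Definition sigma3 : R :=
  9 * a ^+ 2 + 49 * b ^+ 2 + 25 * c ^+ 2 - 20 + 53 * a - 15 * b + 19 * c.

End Sigma.

(* Main.v *)
Require Import Defs.
From HB Require Import structures.
From mathcomp Require Import all_boot all_order all_algebra.
From mathcomp Require Import all_classical all_reals all_analysis.
From mathcomp Require Import ring lra.
Import Order.TTheory GRing.Theory Num.Theory.
Import numFieldNormedType.Exports.
Set Implicit Arguments.
Unset Strict Implicit.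
Unset Printing Implicit Defensive.

(* An independent set of a chain extended by a hexagon is a pair of independent
   sets of the chain and of the hexagon that agree on the merged vertex.  Hence
   the expected numbers of independent sets avoiding, resp. containing, the next
   attachment vertex evolve by the constant symmetric matrix
     M = [[8a+10b+9c, 5a+3b+4c], [5a+3b+4c, 2b+c]],
   starting from (13, 5) for a single hexagon, and E(i_n) is their sum.  When
   a + b + c = 1, M has trace t = 3a+7b+5c+5 and determinant -sigma2, so its
   eigenvalues are r, s = (t +- sigma1) / 2, and E(i_n) = A r^n + B s^n with
   A = (18 - 2s) / sigma1 > 0 and |s| < r.  The right-hand side of the theorem
   is exactly A r^n, because r s = -sigma2. *)

Lemma big_tuple_rcons (R : Type) (idx : R) (op : Monoid.com_law idx)
    (T : finType) (m : nat) (F : m.+1.-tuple T -> R) :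
  \big[op/idx]_s F s
  = \big[op/idx]_(s : m.-tuple T) \big[op/idx]_(x : T) F (rcons_tuple s x).
Proof.
rewrite pair_big /=.
rewrite (reindex (fun sx : m.-tuple T * T => rcons_tuple sx.1 sx.2)) //=.
apply/onW_bij/inj_card_bij; last by rewrite card_prod !card_tuple expnSr.
move=> [s x] [t y] /(congr1 val) /= /rcons_inj[st ->].
by congr pair; apply: val_inj.
Qed.

Lemma big_tuple0 (R : Type) (idx : R) (op : Monoid.law idx) (T : finType)
    (F : 0.-tuple T -> R) :
  \big[op/idx]_s F s = F [tuple].
Proof. by rewrite (big_pred1 [tuple]) // => s; apply/esym/eqP/tuple0. Qed.

Lemma sum_fibers (R : pzSemiRingType) (T : finType) (n : nat) (h : T -> nat)
    (F : T -> R) (g : nat -> R) :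
  (forall x, h x < n)%N ->
  (\sum_x F x * g (h x) = \sum_(d < n) (\sum_(x | h x == d) F x) * g d)%R.
Proof.
move=> h_lt; under [RHS]eq_bigr do rewrite mulr_suml.
rewrite (exchange_big_dep xpredT) //=; apply: eq_bigr => x _.
by rewrite (big_pred1 (Ordinal (h_lt x))) // => d; rewrite eq_sym.
Qed.

Section IndependentSets.
Local Open Scope nat_scope.

Lemma card_fibers (T J : finType) (P : pred T) (f : T -> J) :
  #|[set x | P x]| = \sum_y #|[set x | P x && (f x == y)]|.
Proof.
rewrite cardsE -sum1_card (partition_big f xpredT) //=.
by apply: eq_bigr => y _; rewrite sum1dep_card.
Qed.

Fixpoint bitseqs (n : nat) : seq bitseq :=
  if n isn't m.+1 then [:: [::]]
  else [seq rcons s b | s <- bitseqs m, b <- [:: true; false]].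

Lemma big_bitseqs (R : Type) (idx : R) (op : Monoid.com_law idx) (n : nat)
    (F : bitseq -> R) :
  \big[op/idx]_(s : n.-tuple bool) F s = \big[op/idx]_(s <- bitseqs n) F s.
Proof.
elim: n F => [|n IHn] F; first by rewrite big_tuple0 big_seq1.
rewrite big_tuple_rcons (IHn (fun s => \big[op/idx]_x F (rcons s x))).
rewrite big_allpairs_dep; apply: eq_bigr => s _.
by rewrite big_bool !big_cons big_nil Monoid.mulm1.
Qed.

Lemma card_set_ord_bits (n : nat) (P : pred {set 'I_n}) (Q : pred bitseq) :
    (forall s : n.-tuple bool, P [set i | tnth s i] = Q s) ->
  #|[set A | P A]| = count Q (bitseqs n).
Proof.
move=> PQ; rewrite cardsE -sum1_card -sum1_count big_mkcond [RHS]big_mkcond.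
rewrite -(big_bitseqs _ n (fun s => if Q s then 1 else 0)).
pose of_bits (s : n.-tuple bool) := [set i | tnth s i].
rewrite (reindex of_bits) /=; first by apply: eq_bigr => s _; rewrite -PQ.
apply/onW_bij; exists (fun A : {set 'I_n} => [tuple i \in A | i < n]) => [s|A].
  by apply: eq_from_tnth => i; rewrite tnth_mktuple inE.
by apply/setP => i; rewrite inE tnth_mktuple.
Qed.

Lemma independentP (G : graph) (A : {set G}) :
  reflect (forall x y, x \in A -> y \in A -> ~~ adj x y) (independent A).
Proof.
apply: (iffP 'forall_implyP) => [hA x y xA yA|hA x xA].
  by have /forall_inP/(_ y yA) := hA x xA.
by apply/forall_inP => y; apply: hA.
Qed.

Definition num_indep_at (G : graph) (x : G) (e : bool) : nat :=
  #|[set A : {set G} | independent A && ((x \in A) == e)]|.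

Definition num_indep_at2 (G : graph) (x y : G) (e e' : bool) : nat :=
  #|[set A : {set G}
      | (independent A && ((y \in A) == e')) && ((x \in A) == e)]|.

Lemma num_indep_split (G : graph) (x : G) :
  num_indep G = \sum_e num_indep_at x e.
Proof. exact: (card_fibers _ (fun A : {set G} => x \in A)). Qed.

Lemma num_indep_at_split (G : graph) (x y : G) (e' : bool) :
  num_indep_at y e' = \sum_e num_indep_at2 x y e e'.
Proof. exact: (card_fibers _ (fun A : {set G} => x \in A)). Qed.

Section Glue.
Variables (G H : graph) (u : G) (v : H).
Notation K := (Defs.glue u v).

Lemma glue_inr_root : glue_inr u v v = inl u.
Proof. by rewrite /glue_inr insubF // eqxx. Qed.

Lemma glue_inr_val (x : {x : H | x != v}) : glue_inr u v (val x) = inr x.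
Proof. by rewrite /glue_inr valK. Qed.

Variant glue_inr_spec (x : H) : H -> K -> Type :=
  | GlueInrRoot of x = v : glue_inr_spec x v (inl u)
  | GlueInrVal (y : {x : H | x != v}) of x = val y :
      glue_inr_spec x (val y) (inr y).

Lemma glue_inrP (x : H) : glue_inr_spec x x (glue_inr u v x).
Proof.
have [->|nx] := eqVneq x v; first by rewrite glue_inr_root; constructor.
by rewrite -[x]/(val (Sub x nx : {x : H | x != v})) glue_inr_val; constructor.
Qed.

Lemma adj_glue_inr (x y : H) :
  adj (glue_inr u v x) (glue_inr u v y) = adj x y.
Proof.
case: glue_inrP => [_|x' _]; case: glue_inrP => [_|y' _] //=.
- by rewrite !adj_irr.
- by rewrite eqxx.
- by rewrite eqxx adj_sym.
Qed.

Definition glue_restrict (S : {set K}) : {set G} * {set H} :=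
  ([set x | (inl x : K) \in S], [set y | glue_inr u v y \in S]).

Lemma glue_restrict_inj : injective glue_restrict.
Proof.
move=> S T [/setP eG /setP eH]; apply/setP => -[x|y].
  by have := eG x; rewrite !inE.
by have := eH (val y); rewrite !inE glue_inr_val.
Qed.

Lemma glue_restrict_surj (A : {set G}) (B : {set H}) :
  (u \in A) = (v \in B) -> exists S, glue_restrict S = (A, B).
Proof.
move=> uA.
exists [set z | match z with inl x => x \in A | inr y => val y \in B end].
by congr pair; apply/setP => x; rewrite !inE //; case: glue_inrP.
Qed.

Lemma independent_glue (S : {set K}) :
  independent S
  = independent (glue_restrict S).1 && independent (glue_restrict S).2.
Proof.
apply/independentP/andP => [hS|[/independentP hG /independentP hH]].
  split; apply/independentP => x y; rewrite !inE => xS yS.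
    exact: hS xS yS.
  by rewrite -adj_glue_inr; exact: hS.
move=> [x|x] [y|y] xS yS /=.
- by apply: hG; rewrite inE.
- have [xu|//] := eqVneq x u; apply: hH; rewrite inE ?glue_inr_val //.
  by rewrite glue_inr_root -xu.
- have [yu|//] := eqVneq y u; apply: hH; rewrite inE ?glue_inr_val //.
  by rewrite glue_inr_root -yu.
by apply: hH; rewrite inE glue_inr_val.
Qed.

Lemma num_indep_at2_glue (y : H) (e e' : bool) :
  num_indep_at2 (inl u : K) (glue_inr u v y) e e'
  = num_indep_at u e * num_indep_at2 v y e e'.
Proof.
rewrite /num_indep_at /num_indep_at2 -cardsX -(card_imset _ glue_restrict_inj).
apply: eq_card => -[A B]; rewrite !inE /=; apply/imsetP/idP => [[S]|].
  rewrite !inE independent_glue => /andP[/andP[/andP[iA iB] yS] uS] [-> ->].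
  by rewrite iA iB !inE glue_inr_root uS yS.
case/andP => /andP[iA uA] /andP[/andP[iB yB] vB].
have [|S SE] := @glue_restrict_surj A B; first by rewrite (eqP uA) (eqP vB).
exists S => //; rewrite !inE independent_glue SE iA iB /=.
by move: SE => [AE BE]; move: uA yB; rewrite -AE -BE !inE => -> ->.
Qed.

Lemma num_indep_at_glue (y : H) (e' : bool) :
  num_indep_at (glue_inr u v y) e'
  = \sum_e num_indep_at u e * num_indep_at2 v y e e'.
Proof.
rewrite (num_indep_at_split (inl u : K)).
by apply: eq_bigr => e _; rewrite num_indep_at2_glue.
Qed.

End Glue.

Lemma gdist_shortest_walk (G : graph) (x : G) (p : seq G) :
    path (@adj G) x p -> size p < #|G| ->
    (forall q, path (@adj G) x q -> last x q = last x p -> size p <= size q) ->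
  gdist x (last x p) = size p.
Proof.
move=> xp p_lt p_min; rewrite /gdist; set reach := fun l => _.
have reach_p : reach (size p).
  by apply/existsP; exists (in_tuple p); rewrite /= xp eqxx.
have has_reach : has reach (iota 0 #|G|).
  by apply/hasP; exists (size p); rewrite ?mem_iota.
have find_lt : find reach (iota 0 #|G|) < #|G|.
  by rewrite -[X in _ < X](size_iota 0) -has_find.
apply/eqP; rewrite eqn_leq; apply/andP; split.
  rewrite leqNgt; apply/negP => /(before_find 0).
  by rewrite nth_iota // add0n reach_p.
have := nth_find 0 has_reach; rewrite nth_iota // add0n.
by case/existsP => q /andP[/p_min le_pq /eqP /le_pq]; rewrite size_tuple.
Qed.

Lemma gdist_eq_labelling (G : graph) (x : G) (f : G -> nat) :
    f x = 0 ->
    (forall y z, adj y z -> f z <= (f y).+1) ->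
    (forall z, z != x -> exists2 y, adj y z & f z = (f y).+1) ->
  forall y, f y < #|G| -> gdist x y = f y.
Proof.
move=> fx0 f_adj f_pred y.
have f_last p : path (@adj G) x p -> f (last x p) <= size p.
  elim/last_ind: p => [|p z IHp]; first by rewrite /= fx0.
  rewrite rcons_path last_rcons size_rcons => /andP[/IHp fp /f_adj fz].
  exact: leq_trans fz _.
have [p [xp <- size_p]] : exists p, [/\ path (@adj G) x p, last x p = y
                                      & size p = f (last x p)].
  elim: (f y) {-2}y (erefl (f y)) => {y} [|l IHl] y fy.
    have [->|/f_pred[z _]] := eqVneq y x; first by exists [::]; rewrite fx0.
    by rewrite fy.
  have [z zy fz] : exists2 z, adj z y & f y = (f z).+1.
    by apply: f_pred; apply: contra_eq_neq fy => ->; rewrite fx0.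
  have [|p [xp pz size_p]] := IHl z; first by apply: succn_inj; rewrite -fz.
  exists (rcons p y); rewrite rcons_path last_rcons size_rcons xp size_p.
  by rewrite pz zy fz.
rewrite -size_p => p_lt; apply: gdist_shortest_walk => // q /f_last.
by rewrite size_p => f_q qp; rewrite -qp.
Qed.

Lemma gdist_hexagon (j : hexagon) : gdist (ord0 : hexagon) j = minn j (6 - j).
Proof.
apply: (gdist_eq_labelling (f := fun j : hexagon => minn j (6 - j))) => //.
- move=> y z /orP[] /eqP ->; first by case: y; do 6?[case=> //].
  by case: z; do 6?[case=> //].
- move=> z z_neq0; exists (if z <= 3 then ord_pred z else ordS z).
    by case: z z_neq0; do 6?[case=> //].
  by case: z z_neq0; do 6?[case=> //].
- by rewrite card_ord; case: j; do 6?[case=> //].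
Qed.

Lemma independent_hexagon (A : {set hexagon}) :
  independent A = [forall i : 'I_6, ~~ ((i \in A) && (ordS i \in A))].
Proof.
apply/independentP/forallP => [hA i|hA x y xA yA].
  by apply/negP => /andP[/hA/[apply]]; rewrite /= /hex_adj eqxx.
by apply/norP; split; apply/eqP => e; [move: (hA x) | move: (hA y)];
   rewrite -e xA yA.
Qed.

Definition no_cyclic_neighbours : pred bitseq :=
  cycle (fun x y => ~~ (x && y)).

Lemma independent_hexagon_bits (s : 6.-tuple bool) :
  independent ([set i | tnth s i] : {set hexagon}) = no_cyclic_neighbours s.
Proof.
rewrite independent_hexagon -(big_andE xpredT) !big_ord_recl big_ord0 !inE.
rewrite !(tnth_nth false).
by case/tupleP: s => b0 s; do 5![case/tupleP: s => ? s]; rewrite [s]tuple0.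
Qed.

(* Entry d counts the independent sets of a hexagon whose indicators at two
   vertices at distance d are e and e'. *)
Definition hex_transfer (e e' : bool) (d : nat) : nat :=
  nth 0 (match e, e' with
         | false, false => [:: 13; 8; 10; 9]
         | true, true => [:: 5; 0; 2; 1]
         | _, _ => [:: 0; 5; 3; 4]
         end) d.

Lemma num_indep_at2_hexagon (j : hexagon) (e e' : bool) :
  num_indep_at2 (ord0 : hexagon) j e e'
  = hex_transfer e e' (gdist (ord0 : hexagon) j).
Proof.
rewrite gdist_hexagon /num_indep_at2 (card_set_ord_bits (Q := fun s =>
    (no_cyclic_neighbours s && (nth false s j == e'))
    && (nth false s 0 == e))) => [|s]; last first.
  by rewrite independent_hexagon_bits !inE !(tnth_nth false).
by case: j; do 6?[case=> //]; case: e e' => -[].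
Qed.

Lemma num_indep_at_hexagon (e : bool) :
  num_indep_at (ord0 : hexagon) e = if e then 5 else 13.
Proof.
rewrite (num_indep_at_split (ord0 : hexagon)) big_bool !num_indep_at2_hexagon.
by rewrite gdist_hexagon; case: e.
Qed.

End IndependentSets.

Local Open Scope ring_scope.

Section ProductMean.
Variables (R : comPzSemiRingType) (T : finType) (p : nat -> T -> R).

Definition product_mean (m : nat) (F : seq T -> R) : R :=
  \sum_(s : m.-tuple T) (\prod_(k < m) p k (tnth s k)) * F s.

Lemma eq_product_mean (m : nat) (F F' : seq T -> R) :
    (forall s, size s = m -> F s = F' s) ->
  product_mean m F = product_mean m F'.
Proof. by move=> FF'; apply: eq_bigr => s _; rewrite FF' ?size_tuple. Qed.

Lemma product_mean0 (F : seq T -> R) : product_mean 0 F = F [::].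
Proof. by rewrite /product_mean big_tuple0 big_ord0 mul1r. Qed.

Lemma product_meanS (m : nat) (F : seq T -> R) :
  product_mean m.+1 F
  = product_mean m (fun s => \sum_x p m x * F (rcons s x)).
Proof.
rewrite /product_mean big_tuple_rcons; apply: eq_bigr => s _.
rewrite mulr_sumr; apply: eq_bigr => x _.
rewrite big_ord_recr /= mulrA (tnth_nth x) /= nth_rcons size_tuple ltnn eqxx.
congr (_ * _ * _); apply: eq_bigr => k _.
by rewrite !(tnth_nth x) /= nth_rcons size_tuple ltn_ord.
Qed.

Lemma product_mean_sum (I : finType) (m : nat) (F : I -> seq T -> R) :
  product_mean m (fun s => \sum_i F i s) = \sum_i product_mean m (F i).
Proof.
by rewrite [RHS]exchange_big; apply: eq_bigr => s _; rewrite mulr_sumr.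
Qed.

Lemma product_meanMr (m : nat) (F : seq T -> R) (x : R) :
  product_mean m (fun s => F s * x) = product_mean m F * x.
Proof. by rewrite mulr_suml; apply: eq_bigr => s _; rewrite mulrA. Qed.

End ProductMean.

Definition attach_at (s : seq hexagon) (m : nat) : hexagon :=
  if m is k.+1 then nth ord0 s k else ord0.

Definition chain_tip (s : seq hexagon) (m : nat) : chain_graph (chain s m) :=
  @last_hex (chain s m) (attach_at s m).

Lemma chain_rcons (s : seq hexagon) (j : hexagon) (m : nat) :
  (m <= (size s).+1)%N -> chain (rcons s j) m = chain s m.
Proof.
elim: m => //= m IHm le_m; rewrite IHm 1?ltnW //; congr attach.
by case: m le_m {IHm} => // m le_m; rewrite nth_rcons (ltnSE le_m).
Qed.

Lemma attach_at_rcons (s : seq hexagon) (j : hexagon) (m : nat) :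
  (m <= size s)%N -> attach_at (rcons s j) m = attach_at s m.
Proof. by case: m => //= m le_m; rewrite nth_rcons le_m. Qed.

Lemma num_indep_at_tip_rcons (s : seq hexagon) (j : hexagon) (e' : bool) :
  num_indep_at (chain_tip (rcons s j) (size s).+1) e'
  = (\sum_e num_indep_at (chain_tip s (size s)) e
             * num_indep_at2 (ord0 : hexagon) j e e')%N.
Proof.
rewrite /chain_tip /= chain_rcons // nth_rcons ltnn eqxx.
by rewrite -/(attach_at _ _) attach_at_rcons // num_indep_at_glue.
Qed.

Section RandomChain.
Variables (R : comPzRingType) (p : nat -> hexagon -> R).

Definition expected_tip (m : nat) (e : bool) : R :=
  product_mean p m (fun s => (num_indep_at (chain_tip s m) e)%:R).

Lemma expected_tip0 (e : bool) : expected_tip 0 e = if e then 5 else 13.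
Proof.
by rewrite /expected_tip product_mean0 num_indep_at_hexagon; case: e.
Qed.

Lemma expected_tipS (m : nat) (e' : bool) :
  expected_tip m.+1 e'
  = \sum_e expected_tip m e
           * \sum_j p m j * (num_indep_at2 (ord0 : hexagon) j e e')%:R.
Proof.
under eq_bigr do rewrite -product_meanMr.
rewrite -product_mean_sum /expected_tip product_meanS.
apply: eq_product_mean => s <-.
under [RHS]eq_bigr do rewrite mulr_sumr.
rewrite exchange_big; apply: eq_bigr => j _.
rewrite num_indep_at_tip_rcons natr_sum mulr_sumr.
by apply: eq_bigr => e _; rewrite natrM mulrCA.
Qed.

End RandomChain.

Lemma expected_num_indepE (R : realType) (p : nat -> hexagon -> R) (m : nat) :
    (forall k, \sum_j p k j = 1) ->
  expected_num_indep p m.+1 = \sum_e expected_tip p m e.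
Proof.
move=> p1; rewrite -product_mean_sum.
pose num_chain s := (num_indep (chain_graph (chain s m)))%:R : R.
transitivity (product_mean p m num_chain); last first.
  apply: eq_product_mean => s _.
  by rewrite /num_chain (num_indep_split (chain_tip s m)) natr_sum.
case: m @num_chain => [|m] num_chain; first by [].
rewrite product_meanS.
transitivity (product_mean p m (fun s => (num_indep (cactus s m.+2))%:R)).
  by rewrite /expected_num_indep subSS subn1.
apply: eq_product_mean => s size_s; rewrite /num_chain.
under eq_bigr do rewrite chain_rcons ?size_s //.
by rewrite -mulr_suml p1 mul1r.
Qed.

(* [lra] does not see section hypotheses, hence the [move: habc => *] below. *)
Section StepLaw.
Variables (R : realType) (a b c : R).
Hypothesis habc : a + b + c = 1.

Lemma step_law_mean (p : hexagon -> R) (f : nat -> R) :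
    step_law a b c p ->
  \sum_j p j * f (gdist (ord0 : hexagon) j) = a * f 1%N + b * f 2 + c * f 3.
Proof.
case=> _ p1 pa pb pc.
have gdist_lt4 j : (gdist (ord0 : hexagon) j < 4)%N.
  by rewrite gdist_hexagon; case: j; do 6?[case=> //].
have by_distance := sum_fibers p _ gdist_lt4.
have p0 : \sum_(j | gdist (ord0 : hexagon) j == 0%N) p j = 0.
  have := by_distance (fun=> 1).
  under eq_bigr do rewrite mulr1.
  by rewrite p1 !big_ord_recr big_ord0 /= pa pb pc; move: habc => *; lra.
by rewrite by_distance !big_ord_recr big_ord0 /= p0 pa pb pc mul0r !add0r.
Qed.

Definition mean_transfer (e e' : bool) : R :=
  a * (hex_transfer e e' 1)%:R + b * (hex_transfer e e' 2)%:R
  + c * (hex_transfer e e' 3)%:R.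

Variable p : nat -> hexagon -> R.
Hypothesis hp : forall k, step_law a b c (p k).

Lemma expected_tip_transfer (m : nat) (e' : bool) :
  expected_tip p m.+1 e' = \sum_e expected_tip p m e * mean_transfer e e'.
Proof.
rewrite expected_tipS; apply: eq_bigr => e _; congr (_ * _).
pose f d : R := (hex_transfer e e' d)%:R.
rewrite -[mean_transfer e e'](step_law_mean f (hp m)).
by apply: eq_bigr => j _; rewrite num_indep_at2_hexagon.
Qed.

Lemma expected_num_indep1 : expected_num_indep p 1 = 18.
Proof.
rewrite expected_num_indepE => [|k]; last by case: (hp k).
by rewrite big_bool !expected_tip0 /=; ring.
Qed.

Lemma expected_num_indep2 : expected_num_indep p 2 = 194.
Proof.
rewrite expected_num_indepE => [|k]; last by case: (hp k).
rewrite big_bool !expected_tip_transfer !big_bool !expected_tip0.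
by move: habc => *; rewrite /mean_transfer /hex_transfer /=; lra.
Qed.

End StepLaw.

(* The Cayley-Hamilton theorem for a 2x2 matrix acting on row vectors. *)
Lemma transfer_recurrence (R : comPzRingType) (M : bool -> bool -> R)
    (x : nat -> bool -> R) :
    (forall n e', x n.+1 e' = \sum_e x n e * M e e') ->
  forall n e, x n.+2 e
    = (M false false + M true true) * x n.+1 e
      - (M false false * M true true - M false true * M true false) * x n e.
Proof.
by move=> xS n e; rewrite !xS !big_bool /= !xS !big_bool /=; case: e; ring.
Qed.

Lemma linear_recurrence_binet (F : fieldType) (r s : F) (u : nat -> F) :
    (forall n, u n.+2 = (r + s) * u n.+1 - r * s * u n) -> r != s ->
  forall n, u n = (u 1%N - s * u 0%N) / (r - s) * r ^+ n
                  + (r * u 0%N - u 1%N) / (r - s) * s ^+ n.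
Proof.
move=> u_rec rs_neq n; have rs_neq0 : r - s != 0 by rewrite subr_eq0.
set A := _ / _; set B := _ / _.
have u0 : u 0%N = A + B by rewrite /A /B; field.
have u1 : u 1%N = A * r + B * s by rewrite /A /B; field.
elim/ltn_ind: n => -[|[|n]] IHn; rewrite ?expr0 ?mulr1 //.
by rewrite u_rec !IHn // !exprS; ring.
Qed.

Local Open Scope classical_set_scope.

Lemma linear_recurrence_equiv (R : archiRealFieldType) (r s : R)
    (u : nat -> R) :
    (forall n, u n.+2 = (r + s) * u n.+1 - r * s * u n) ->
    `|s| < `|r| -> u 1%N != s * u 0%N ->
  (fun n => u n / ((u 1%N - s * u 0%N) / (r - s) * r ^+ n)) @ \oo --> (1 : R).
Proof.
move=> u_rec lt_sr u1_neq.
have r_neq0 : r != 0 by rewrite -normr_gt0 (le_lt_trans _ lt_sr).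
have rs_neq : r != s by apply: contraTneq lt_sr => ->; rewrite ltxx.
pose A := (u 1%N - s * u 0%N) / (r - s).
pose B := (r * u 0%N - u 1%N) / (r - s).
have A_neq0 : A != 0 by rewrite mulf_neq0 ?invr_eq0 ?subr_eq0.
have -> : (fun n => u n / (A * r ^+ n))
    = (fun n => 1 + geometric (B / A) (s / r) n).
  apply/funext => n.
  rewrite (linear_recurrence_binet u_rec rs_neq) -/A -/B /= expr_div_n.
  by field; rewrite A_neq0 expf_neq0.
rewrite -[X in _ --> X]addr0; apply: cvgD; first exact: cvg_cst.
by apply: cvg_geometric; rewrite normrM normfV ltr_pdivrMr ?normr_gt0 // mul1r.
Qed.

Section Roots.
Variables (R : realType) (a b c : R).
Hypotheses (ha : 0 <= a) (hb : 0 <= b) (hc : 0 <= c) (habc : a + b + c = 1).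
Local Notation t := (3 * a + 7 * b + 5 * c + 5).
Local Notation s1 := (sigma1 a b c).
Local Notation s2 := (sigma2 a b c).

Definition dominant_root : R := (t + s1) / 2.
Definition subdominant_root : R := (t - s1) / 2.
Local Notation r := dominant_root.
Local Notation s := subdominant_root.

Let cE : c = 1 - a - b.
Proof. by rewrite -habc; ring. Qed.

Lemma sigma1_gt0 : 0 < s1.
Proof.
rewrite sqrtr_gt0 ltr_wpDl ?ltr0n //.
by rewrite !addr_ge0 ?mulr_ge0 ?exprn_ge0.
Qed.

Lemma sigma1_sqr : s1 ^+ 2 = t ^+ 2 + 4 * s2.
Proof.
rewrite sqr_sqrtr; last by rewrite !addr_ge0 ?mulr_ge0 ?exprn_ge0.
by rewrite /sigma2 cE; ring.
Qed.

Lemma rootsD : r + s = t.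
Proof. by rewrite /r /s; field. Qed.

Lemma rootsB : r - s = s1.
Proof. by rewrite /r /s; field. Qed.

Lemma rootsM : r * s = - s2.
Proof.
have -> : r * s = (t ^+ 2 - s1 ^+ 2) / 4 by rewrite /r /s; field.
by rewrite sigma1_sqr; field.
Qed.

Lemma norm_subdominant_root_lt : `|s| < `|r|.
Proof.
have s1_gt0 := sigma1_gt0.
have r_gt0 : 0 < r by move: ha hb hc => *; rewrite /r; lra.
by rewrite (gtr0_norm r_gt0) ltr_norml /r /s; move: ha hb hc => *; lra.
Qed.

Lemma subdominant_root_lt9 : s < 9.
Proof. by move: ha hb hc habc sigma1_gt0 => *; rewrite /s; lra. Qed.

Lemma expected_num_indep_rec (p : nat -> hexagon -> R) :
    (forall k, step_law a b c (p k)) ->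
  forall n, expected_num_indep p n.+3
    = (r + s) * expected_num_indep p n.+2 - r * s * expected_num_indep p n.+1.
Proof.
move=> hp n.
have trace_transfer :
    mean_transfer a b c false false + mean_transfer a b c true true = r + s.
  by rewrite rootsD /mean_transfer /hex_transfer /= cE; ring.
have det_transfer :
    mean_transfer a b c false false * mean_transfer a b c true true
    - mean_transfer a b c false true * mean_transfer a b c true false = r * s.
  by rewrite rootsM /mean_transfer /hex_transfer /sigma2 /= cE; ring.
have tip_rec := transfer_recurrence (expected_tip_transfer habc hp).
have p1 k : \sum_j p k j = 1 by case: (hp k).
rewrite !(expected_num_indepE _ p1) !big_bool /= !tip_rec.
by rewrite trace_transfer det_transfer; ring.
Qed.

Hypothesis sigma2_neq0 : s2 != 0.

Lemma roots_neq0 : r != 0 /\ s != 0.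
Proof. by apply/andP; rewrite -negb_or -mulf_eq0 rootsM oppr_eq0. Qed.

Lemma asymptotic_numeratorE :
  - 3 * a * s1 - 7 * b * s1 - 5 * c * s1
  + 42 * a * b + 30 * a * c + 70 * b * c + 4 * s1 + sigma3 a b c
  = - s * (18 - 2 * s).
Proof.
transitivity ((s1 ^+ 2 + s1 * (18 - 2 * t) - 18 * t + t ^+ 2) / 2); last first.
  by rewrite /s; field.
by rewrite sigma1_sqr /sigma2 /sigma3 cE; field.
Qed.

Lemma asymptotic_baseE : - ((3 * a + 7 * b + 5 * c - s1 + 5) / s2) = 2 / r.
Proof.
have [r_neq0 s_neq0] := roots_neq0.
have -> : 3 * a + 7 * b + 5 * c - s1 + 5 = 2 * s by rewrite /s; field.
by rewrite -[s2]opprK -rootsM; field; rewrite r_neq0.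
Qed.

Lemma asymptotic_formE (n : nat) :
  1 / (1 / 2) ^+ n.+2 * (- s * (18 - 2 * s)) / ((2 / r) ^+ n.+2 * s1 * s2)
  = (194 - s * 18) / (r - s) * r ^+ n.
Proof.
have [r_neq0 s_neq0] := roots_neq0.
have s1_neq0 : s1 != 0 by rewrite lt0r_neq0 ?sigma1_gt0.
have -> : 194 - s * 18 = r * (18 - 2 * s).
  have -> : r * (18 - 2 * s) = 18 * (r + s) - 18 * s - 2 * (r * s) by ring.
  by rewrite rootsD rootsM /sigma2 /s cE; ring.
rewrite rootsB -[s2]opprK -rootsM (expr_div_n 1) (expr_div_n 2) expr1n !exprS.
have : (2 : R) ^+ n != 0 by rewrite expf_neq0.
have := expf_neq0 n r_neq0.
move: (r ^+ n) (2 ^+ n) => rn twon rn_neq0 twon_neq0.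
by field; rewrite rn_neq0 twon_neq0 r_neq0 s1_neq0 s_neq0.
Qed.

End Roots.

Theorem theorem6 (R : realType) (a b c : R) (p : nat -> hexagon -> R)
    (ha : 0 <= a) (hb : 0 <= b) (hc : 0 <= c) (habc : a + b + c = 1)
    (hp : forall k, step_law a b c (p k))
    (hs2 : sigma2 a b c != 0) :
  let s1 := sigma1 a b c in
  let s2 := sigma2 a b c in
  let s3 := sigma3 a b c in
  (fun n : nat => expected_num_indep p n /
     ((1 / (1 / 2) ^+ n.+1
        * (- 3 * a * s1 - 7 * b * s1 - 5 * c * s1
           + 42 * a * b + 30 * a * c + 70 * b * c + 4 * s1 + s3))
      / ((- ((3 * a + 7 * b + 5 * c - s1 + 5) / s2)) ^+ n.+1 * s1 * s2)))
    @ \oo --> (1 : R).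
Proof.
move=> s1 s2 s3; rewrite {}/s1 {}/s2 {}/s3.
have E1 := expected_num_indep1 hp; have E2 := expected_num_indep2 habc hp.
rewrite -cvg_shiftS /= asymptotic_numeratorE // asymptotic_baseE //.
under eq_cvg do rewrite asymptotic_formE // -E1 -E2.
apply: (linear_recurrence_equiv (u := fun n => expected_num_indep p n.+1)).
- exact: expected_num_indep_rec.
- exact: norm_subdominant_root_lt.
- by rewrite E1 E2; have := subdominant_root_lt9 ha hb hc habc; lra.
Qed.
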